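(* Let $1<p<\infty$, $1/p+1/q=1$, and let $\{z_0,z_1,\ldots,z_n\}$ be distinct points of $\mathbb{D}$. Let $\Psi$ be the matrix with entries $[\Psi]_{j,k}=z_k^j(1-|z_k|^q)^{1/q}$, $j\ge0$, $0\le k\le n$. Let $\tilde a\in\ell^q(\{0,1,\ldots,n\})$ and $\tilde b\in\ell^p$ be unit vectors such that $\|\Psi\tilde a\|_q=\|\Psi\|$, $\|\Psi^T\tilde b\|_p=\|\Psi\|$ and $\langle\tilde b,\Psi\tilde a\rangle=\|\Psi\|$. Then $$\tilde a=\frac{\big[\Psi^T(\Psi\tilde a)^{\langle q-1\rangle}\big]^{\langle p-1\rangle}}{\|\Psi\|^p}\qquad\text{and}\qquad\tilde b=\frac{\big[\Psi(\Psi^T\tilde b)^{\langle p-1\rangle}\big]^{\langle q-1\rangle}}{\|\Psi\|^q}.$$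
   Context: $\mathbb{D}$ is the open unit disk in $\mathbb{C}$. $\ell^p,\ell^q$ are the complex sequence spaces indexed by $\{0,1,2,\ldots\}$; $\ell^q(\{0,\ldots,n\})$ is $\mathbb{C}^{n+1}$ with the $\ell^q$ norm (similarly for $p$). $\|\Psi\|$ is the operator norm of $\Psi:\ell^q(\{0,\ldots,n\})\to\ell^q$; $\Psi^T$ is the transpose (no conjugation); $z_k^0=1$. The pairing is bilinear: $\langle b,c\rangle=\sum_kb_kc_k$ for $b\in\ell^p$, $c\in\ell^q$. For $\alpha=re^{i\theta}\in\mathbb{C}$ and $s>0$, $\alpha^{\langle s\rangle}:=r^se^{-i\theta}$ (with $0^{\langle s\rangle}=0$), and for a vector $A=(a_k)$, $A^{\langle s\rangle}:=(a_k^{\langle s\rangle})$. *)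

(* Defs.v *)
From HB Require Import structures.
From mathcomp Require Import all_boot all_order all_algebra.
From mathcomp Require Export complex.
From mathcomp Require Import all_classical all_reals all_analysis.

Set Implicit Arguments.
Unset Strict Implicit.
Unset Printing Implicit Defensive.

Import Order.TTheory GRing.Theory Num.Theory numFieldNormedType.Exports.
Import ComplexField.Normc.

Local Open Scope classical_set_scope.
Local Open Scope ring_scope.
Local Open Scope complex_scope.

(* Extended-real valued, so that x belongs to l^p(I) iff lpnorm p x < +oo; see
   lpnorm_seq and lpnorm_fin for I = nat and for finite I. *)
Definition lpnorm {R : realType} {I : choiceType} (p : R) (x : I -> R[i]) : \bar R :=
  ((\esum_(i in [set: I]) (normc (x i) `^ p)%:E) `^ p^-1)%E.

Lemma lpnorm_seq (R : realType) (p : R) (x : nat -> R[i]) :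
  0 < p -> lpnorm p x = 'N[counting]_(p%:E)[EFin \o (@normc R \o x)]%E.
Proof.
move=> p0; rewrite Lnorm_counting// /lpnorm -nneseries_esumT; last first.
  by move=> j; rewrite lee_fin powR_ge0.
congr (_ `^ _)%E; apply: eq_eseriesr => j _ /=.
by rewrite ger0_norm// /normc; case: (x j) => a b; rewrite sqrtr_ge0.
Qed.

Lemma lpnorm_fin (R : realType) (I : finType) (p : R) (x : I -> R[i]) :
  lpnorm p x = ((\sum_i normc (x i) `^ p) `^ p^-1)%:E.
Proof.
rewrite /lpnorm esum_fset; [|exact: finite_finset|]; last first.
  by move=> i _; rewrite lee_fin powR_ge0.
rewrite (fsbigE (index_enum I)) ?index_enum_uniq//; last first.
  by move=> i _; rewrite mem_index_enum.
by under eq_bigl do rewrite in_setT; rewrite sumEFin poweR_EFin.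
Qed.

(* On R[i]^o, limn is the limit in the topology of the complex modulus. *)
Definition csum {R : realType} (f : nat -> R[i]) : R[i] :=
  limn (series (f : nat -> R[i]^o)).

Definition pairing {R : realType} (b c : nat -> R[i]) : R[i] :=
  csum (fun j => b j * c j).

Definition mulmv {R : realType} {m : nat} (M : nat -> 'I_m -> R[i])
    (a : 'I_m -> R[i]) : nat -> R[i] :=
  fun j => \sum_k M j k * a k.

Definition mulmvT {R : realType} {m : nat} (M : nat -> 'I_m -> R[i])
    (b : nat -> R[i]) : 'I_m -> R[i] :=
  fun k => csum (fun j => M j k * b j).

Definition opnorm {R : realType} {m : nat} (q : R) (M : nat -> 'I_m -> R[i]) :
    \bar R :=
  ereal_sup [set lpnorm q (mulmv M a) | a in [set a | (lpnorm q a <= 1)%E]].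

(* If alpha = r e^(i theta) with r > 0, then conjc alpha / r = e^(- i theta);
   if alpha = 0 the value is 0. *)
Definition cpow {R : realType} (alpha : R[i]) (s : R) : R[i] :=
  (normc alpha `^ s)%:C * (conjc alpha / (normc alpha)%:C).

Lemma cpow_polar (R : realType) (r theta s : R) : 0 <= r -> 0 < s ->
  cpow (r%:C * (cos theta +i* sin theta)) s =
  (r `^ s)%:C * (cos theta -i* sin theta).
Proof.
move=> r0 s0; rewrite /cpow normcM.
have -> : normc (cos theta +i* sin theta) = 1.
  by rewrite /normc cos2Dsin2 sqrtr1.
have -> : normc r%:C = r by rewrite /= expr0n addr0 sqrtr_sqr ger0_norm.
rewrite mulr1; have [->|rn0] := eqVneq r 0.
  by rewrite powR0 ?gt_eqF// !mul0r.
congr (_ * _); rewrite rmorphM/= oppr0 mulrAC divff ?mul1r//.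
by rewrite (_ : 0 = 0%:C)// (inj_eq (@complexI R)).
Qed.

Definition vpow {R : realType} {I : Type} (A : I -> R[i]) (s : R) : I -> R[i] :=
  fun i => cpow (A i) s.

Definition Psi {R : realType} {m : nat} (q : R) (z : 'I_m -> R[i]) :
    nat -> 'I_m -> R[i] :=
  fun j k => z k ^+ j * ((1 - normc (z k) `^ q) `^ q^-1)%:C.

(* Main.v *)
Require Import Defs.
From mathcomp Require Import all_boot all_order all_algebra.
From mathcomp Require Import all_classical all_reals all_analysis.
From mathcomp Require Import ring lra.

Set Implicit Arguments.
Unset Strict Implicit.
Unset Printing Implicit Defensive.

Import Order.TTheory GRing.Theory Num.Theory numFieldNormedType.Exports.
Import ComplexField.Normc.

Local Open Scope classical_set_scope.
Local Open Scope ring_scope.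
Local Open Scope complex_scope.

(** Write N for the operator norm of M. The vector b has norm 1 in l^p, M a has
    norm N in l^q, and their pairing is N: this is equality in Hölder's
    inequality, which forces N^(q - 1) b = (M a)^<q - 1>
    ([holder_eq_series]). Moving M across the pairing, a and M^T b are likewise
    in the case of equality, so N^(p - 1) a = (M^T b)^<p - 1>
    ([holder_eq_sum]). Replacing b in the second identity by its value from the
    first, and a in the first by its value from the second, gives both formulas,
    the powers of N combining through (p - 1) (q - 1) = 1 ([extremal_pair]).

    Equality in Hölder's inequality is reduced to equality in Young's inequality
    for each pair of entries ([young_eq_scaled]): the gaps in Young's inequality
    are nonnegative and sum to 0.

    For the matrix Psi it remains to see that 0 < N < oo. Finiteness holds
    because N is the norm of M^T b, a vector with finitely many entries;
    positivity, because the first column of Psi does not vanish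
    ([lpnorm_column]). *)

(** * Complex numbers and conjugate exponents *)

Lemma normc_ge0 (R : rcfType) (x : R[i]) : 0 <= normc x.
Proof. by case: x => a b; exact: sqrtr_ge0. Qed.

Lemma normc_real (R : rcfType) (r : R) : 0 <= r -> normc r%:C = r.
Proof. by move=> r0; rewrite /= expr0n addr0 sqrtr_sqr ger0_norm. Qed.

Lemma realc_eq0 (R : rcfType) (r : R) : (r%:C == 0) = (r == 0).
Proof. exact: (inj_eq (@complexI R)). Qed.

Lemma absRe_le_normc (R : rcfType) (x : R[i]) : `|complex.Re x| <= normc x.
Proof.
case: x => a b /=; rewrite -sqrtr_sqr ler_wsqrtr// lerDl; exact: sqr_ge0.
Qed.

Lemma absIm_le_normc (R : rcfType) (x : R[i]) : `|complex.Im x| <= normc x.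
Proof.
case: x => a b /=; rewrite -sqrtr_sqr ler_wsqrtr// lerDr; exact: sqr_ge0.
Qed.

Lemma Re_le_normc (R : rcfType) (x : R[i]) : complex.Re x <= normc x.
Proof. exact: le_trans (ler_norm _) (absRe_le_normc x). Qed.

Lemma Re_eq_normc (R : rcfType) (x : R[i]) :
  complex.Re x = normc x -> x = (normc x)%:C.
Proof.
case: x => a b /= ea; rewrite -ea.
have := congr1 (fun t => t ^+ 2) ea => /=.
rewrite sqr_sqrtr ?addr_ge0 ?sqr_ge0// => /eqP.
by rewrite -subr_eq0 opprD addNKr oppr_eq0 sqrf_eq0 => /eqP ->.
Qed.

Lemma Re_sum (R : rcfType) (I : Type) (r : seq I) (F : I -> R[i]) :
  complex.Re (\sum_(i <- r) F i) = \sum_(i <- r) complex.Re (F i).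
Proof. by apply: (big_morph (@complex.Re R)) => // -[? ?] [? ?]. Qed.

Lemma Im_sum (R : rcfType) (I : Type) (r : seq I) (F : I -> R[i]) :
  complex.Im (\sum_(i <- r) F i) = \sum_(i <- r) complex.Im (F i).
Proof. by apply: (big_morph (@complex.Im R)) => // -[? ?] [? ?]. Qed.

Lemma mulcJE (R : rcfType) (x : R[i]) : x * conjc x = ((normc x) ^+ 2)%:C.
Proof.
case: x => a b; rewrite /= sqr_sqrtr ?addr_ge0 ?sqr_ge0//.
by apply/eqP; rewrite eq_complex /=; apply/andP; split; apply/eqP; ring.
Qed.

Lemma conj_exp (R : realType) (p q : R) : 1 < p -> p^-1 + q^-1 = 1 ->
  1 < q /\ (p - 1) * (q - 1) = 1.
Proof.
move=> p1 pq.
have p0 : 0 < p by lra.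
have ip1 : p^-1 < 1 by rewrite invf_lt1.
have ip0 : 0 < p^-1 by rewrite invr_gt0.
have iq0 : 0 < q^-1 by lra.
have q0 : 0 < q by rewrite -invr_gt0.
split; first by rewrite -invf_lt1//; lra.
have : p * q * (p^-1 + q^-1) = p * q by rewrite pq mulr1.
rewrite mulrDr mulrAC divff ?gt_eqF// mul1r -mulrA divff ?gt_eqF// mulr1; lra.
Qed.

(** * Equality in Young's inequality *)

(** Let w = x y be the weighted geometric mean of x ^ p and y ^ q, and write
    x ^ p = w e^u, y ^ q = w e^v; then u / p + v / q = 0. Strict convexity, in
    the form e^u > 1 + u for u <> 0, makes the arithmetic mean
    w (e^u / p + e^v / q) exceed w unless u = v = 0. *)
Lemma young_eq (R : realType) (p q x y : R) : 1 < p -> p^-1 + q^-1 = 1 ->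
  0 <= x -> 0 <= y -> x `^ p / p + y `^ q / q <= x * y -> x `^ p = y `^ q.
Proof.
move=> p1 pq x0 y0 h.
have [q1 _] := conj_exp p1 pq.
have p0 : 0 < p by lra.
have q0 : 0 < q by lra.
have ip0 : 0 < p^-1 by rewrite invr_gt0.
have iq0 : 0 < q^-1 by rewrite invr_gt0.
have [xe|xn] := eqVneq x 0.
  move: h; rewrite xe mul0r powR0 ?gt_eqF// mul0r add0r => h.
  have := powR_ge0 y q; rewrite le_eqVlt => /predU1P[<-//|yq].
  by have := divr_gt0 yq q0; lra.
have [ye|yn] := eqVneq y 0.
  move: h; rewrite ye mulr0 powR0 ?gt_eqF// mul0r addr0 => h.
  have := powR_ge0 x p; rewrite le_eqVlt => /predU1P[<-//|xp].
  by have := divr_gt0 xp p0; lra.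
have {}x0 : 0 < x by rewrite lt_def xn.
have {}y0 : 0 < y by rewrite lt_def yn.
set w := x * y in h.
have w0 : 0 < w by rewrite mulr_gt0.
pose u := p * ln x - ln w; pose v := q * ln y - ln w.
have xE : x `^ p = w * expR u.
  by rewrite /powR (negbTE xn) /u expRD expRN lnK ?posrE// mulrCA divff ?mulr1// gt_eqF.
have yE : y `^ q = w * expR v.
  by rewrite /powR (negbTE yn) /v expRD expRN lnK ?posrE// mulrCA divff ?mulr1// gt_eqF.
have uv : u / p + v / q = 0.
  rewrite /u /v !mulrBl (mulrAC p) (mulrAC q) !divff ?gt_eqF// !mul1r.
  rewrite addrACA -opprD -mulrDr pq mulr1 /w lnM ?posrE//; lra.
have {}h : expR u / p + expR v / q <= 1.
  by rewrite -(ler_pM2l w0) mulrDr mulr1 !mulrA -xE -yE.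
have [ue|un] := eqVneq u 0.
  have v0 : v = 0.
    by move/eqP: uv; rewrite ue mul0r add0r mulf_eq0 (gt_eqF iq0) orbF => /eqP.
  by rewrite xE yE ue v0.
exfalso.
have hu : (1 + u) / p < expR u / p by rewrite ltr_pM2r// expR_gt1Dx.
have hv : (1 + v) / q <= expR v / q by rewrite ler_pM2r// expR_ge1Dx.
(* mulrDl would otherwise see through the definitions of u and v *)
clearbody u v; move: hu hv; rewrite !mulrDl !mul1r; lra.
Qed.

(** The second equality case, Re (u v) = |u| |v|, fixes the argument of u as
    that of the conjugate of v; the first one, |u| ^ p = |v| ^ q, fixes its
    modulus as |v| ^ (q - 1), because q / p = q - 1. *)
Lemma young_eq_complex (R : realType) (p q : R) (u v : R[i]) :
  1 < p -> p^-1 + q^-1 = 1 ->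
  normc u `^ p / p + normc v `^ q / q <= complex.Re (u * v) ->
  u = cpow v (q - 1).
Proof.
move=> p1 pq h.
have [q1 pq1] := conj_exp p1 pq.
have uv := Re_le_normc (u * v); rewrite normcM in uv.
have e := young_eq p1 pq (normc_ge0 u) (normc_ge0 v) (le_trans h uv).
have nu : normc u = normc v `^ (q - 1).
  apply: (@powR_injective _ p); rewrite ?nnegrE ?powR_ge0 ?normc_ge0//; first lra.
  by rewrite /= e -powRrM; congr (_ `^ _); lra.
have {uv} uv : u * v = (normc u * normc v)%:C.
  rewrite -normcM; apply: Re_eq_normc; apply/le_anti; rewrite Re_le_normc/= normcM.
  by apply: le_trans h; apply: conjugate_powR; rewrite ?normc_ge0//; lra.
have [v0|v0] := eqVneq v 0.
  rewrite /cpow v0 conjc0 mul0r mulr0; apply: eq0_normc.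
  by rewrite nu v0 normc0 powR0//; lra.
rewrite /cpow -nu.
have nv0 : normc v != 0 by apply: contra_neq v0; exact: eq0_normc.
have nvC : (normc v)%:C != 0 :> R[i] by rewrite realc_eq0.
have : u * v * conjc v = (normc u * normc v)%:C * conjc v by rewrite uv.
rewrite -mulrA mulcJE !rmorphM/= => E.
apply: (mulIf nvC); apply: (mulIf nvC); rewrite -mulrA E; field.
exact: nvC.
Qed.

Lemma cpow_scale (R : realType) (r s : R) (x : R[i]) : 0 < r ->
  cpow (r%:C * x) s = (r `^ s)%:C * cpow x s.
Proof.
move=> r0; rewrite /cpow normcM normc_real ?ltW// powRM ?normc_ge0 ?ltW//.
rewrite !rmorphM /= oppr0 -mulrA; congr (_ * _); congr (_ * _).
by rewrite invfM mulrACA divff ?mul1r// realc_eq0 gt_eqF.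
Qed.

Lemma young_scale (R : realType) (q N : R) (u v : R[i]) : 0 < N ->
  normc (N^-1%:C * v) `^ q / q = normc v `^ q / (N `^ q * q) /\
  complex.Re (u * (N^-1%:C * v)) = complex.Re (u * v) / N.
Proof.
move=> N0; have iN : 0 <= N^-1 by rewrite invr_ge0 ltW.
split.
  rewrite normcM normc_real// powRM ?normc_ge0// -powR_inv1 ?ltW//.
  by rewrite -powRrM mulN1r powRN invfM; ring.
by case: u => ? ?; case: v => ? ? /=; ring.
Qed.

(** Young's inequality for u and v / N, stated in terms of v: summed over the
    entries of a unit vector u of l^p and a vector v of l^q of norm N it becomes
    Hölder's inequality. *)
Lemma young_scaled (R : realType) (p q N : R) (u v : R[i]) :
  1 < p -> p^-1 + q^-1 = 1 -> 0 < N ->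
  complex.Re (u * v) / N <= normc u `^ p / p + normc v `^ q / (N `^ q * q).
Proof.
move=> p1 pq N0; have [q1 _] := conj_exp p1 pq.
have [<- <-] := young_scale q u v N0.
rewrite (le_trans (Re_le_normc _))// normcM.
by apply: conjugate_powR; rewrite ?normc_ge0//; lra.
Qed.

Lemma young_eq_scaled (R : realType) (p q N : R) (u v : R[i]) :
  1 < p -> p^-1 + q^-1 = 1 -> 0 < N ->
  normc u `^ p / p + normc v `^ q / (N `^ q * q) <= complex.Re (u * v) / N ->
  cpow v (q - 1) = (N `^ (q - 1))%:C * u.
Proof.
move=> p1 pq N0; have [<- <-] := young_scale q u v N0 => /(young_eq_complex p1 pq) ->.
rewrite -cpow_scale// mulrA -rmorphM/= divff ?gt_eqF//.
by rewrite (_ : 1%:C = 1)// mul1r.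
Qed.

(** * Convergent complex series *)

(** The value of csum is meaningful only for convergent series, so convergence
    has to be carried along explicitly. *)
Definition csums (R : realType) (f : nat -> R[i]) (l : R[i]) : Prop :=
  series (f : nat -> R[i]^o) @ \oo --> (l : R[i]^o).

Lemma csums_unique (R : realType) (f : nat -> R[i]) (l : R[i]) :
  csums f l -> csum f = l.
Proof. by move=> fl; exact: (@cvg_lim _ (@norm_hausdorff _ R[i]^o) _ _ _ _ _ fl). Qed.

Lemma csumsZ (R : realType) (c : R[i]) (f : nat -> R[i]) (l : R[i]) :
  csums f l -> csums (fun j => c * f j) (c * l).
Proof.
move=> fl; rewrite /csums.
have -> : series (fun j => c * f j : R[i]^o) =
   (fun n => c * series (f : nat -> R[i]^o) n).
  by apply/funext => n; rewrite /series /= mulr_sumr.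
exact: (@cvgMl_tmp R[i]).
Qed.

Lemma csums_sum (R : realType) (I : finType) (f : I -> nat -> R[i]) (l : I -> R[i]) :
  (forall k, csums (f k) (l k)) -> csums (fun j => \sum_k f k j) (\sum_k l k).
Proof.
move=> fl; rewrite /csums.
have -> : series (fun j => \sum_k f k j : R[i]^o) =
   (fun n => \sum_k series (f k : nat -> R[i]^o) n).
  by apply/funext => n; rewrite /series /= exchange_big.
apply: cvg_big; first exact: add_continuous.
by move=> k _; exact: fl.
Qed.

Lemma csums_Re (R : realType) (f : nat -> R[i]) (l : R[i]) :
  csums f l -> series (fun j => complex.Re (f j)) @ \oo --> complex.Re l.
Proof.
move=> fl; apply/cvgrPdist_lt => e e0.
have /(@cvgrPdist_lt _ R[i]^o) /(_ e%:C) := fl; rewrite ltcR => /(_ e0).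
apply: filterS => n; rewrite (_ : `| _ | = (normc (l - series (f : nat -> R[i]^o) n))%:C)// ltcR.
apply: le_lt_trans.
have -> : series (fun j => complex.Re (f j)) n = complex.Re (series (f : nat -> R[i]^o) n).
  by rewrite /series /= -Re_sum.
suff -> : complex.Re l - complex.Re (series (f : nat -> R[i]^o) n) =
    complex.Re (l - series (f : nat -> R[i]^o) n) by exact: absRe_le_normc.
by case: l {fl} => ? ?; case: (series _ n).
Qed.

Lemma csums_ReIm (R : realType) (f : nat -> R[i]) (x y : R) :
  series (fun j => complex.Re (f j)) @ \oo --> x ->
  series (fun j => complex.Im (f j)) @ \oo --> y -> csums f (x +i* y).
Proof.
move=> /cvgrPdist_lt fx /cvgrPdist_lt fy; apply/(@cvgrPdist_lt _ R[i]^o) => -[e e'].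
rewrite ltcE/= => /andP[/eqP -> e0].
have e20 : 0 < e / 2 by rewrite divr_gt0.
near=> n.
have hu : `|x - series (fun j => complex.Re (f j)) n| < e / 2 by near: n; exact: fx.
have hv : `|y - series (fun j => complex.Im (f j)) n| < e / 2 by near: n; exact: fy.
have -> : series (f : nat -> R[i]^o) n =
   series (fun j => complex.Re (f j)) n +i* series (fun j => complex.Im (f j)) n.
  by rewrite /series /= -Re_sum -Im_sum; case: (\sum_(_ <= _ < _) _).
rewrite (_ : `| _ | = (normc ((x - series (fun j => complex.Re (f j)) n) +i*
 (y - series (fun j => complex.Im (f j)) n)))%:C)// ltcR.
set u := x - _ in hu *; set v := y - _ in hv *.
have -> : u +i* v = (u +i* 0) + (0 +i* v).
  by apply/eqP; rewrite eq_complex/= addr0 add0r !eqxx.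
apply: le_lt_trans (le_normcD _ _) _.
rewrite /= !expr0n addr0 add0r !sqrtr_sqr; lra.
Unshelve. all: by end_near. Qed.

(** The real and imaginary parts converge absolutely, hence converge by
    completeness of R. *)
Lemma csums_abs (R : realType) (f : nat -> R[i]) (g : nat -> R) :
  (forall j, normc (f j) <= g j) -> cvgn (series g) -> csums f (csum f).
Proof.
move=> fg cg.
have cv (h : nat -> R) : (forall j, `|h j| <= normc (f j)) -> cvgn (series h).
  move=> hf; apply: normed_cvg; apply: (series_le_cvg _ _ _ cg) => n.
  - exact: normr_ge0.
  - exact: le_trans (normc_ge0 _) (fg n).
  - exact: le_trans (hf n) (fg n).
have /cv cR : forall j, `|complex.Re (f j)| <= normc (f j).
  by move=> j; exact: absRe_le_normc.
have /cv cI : forall j, `|complex.Im (f j)| <= normc (f j).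
  by move=> j; exact: absIm_le_normc.
have h := csums_ReIm cR cI.
by rewrite (csums_unique h).
Qed.

Lemma cvg_series_eq0 (R : realType) (f : nat -> R) : (forall j, 0 <= f j) ->
  series f @ \oo --> (0 : R) -> forall j, f j = 0.
Proof.
move=> f0 cf j; apply/le_anti; rewrite f0 andbT.
have nd : {homo series f : n m / (n <= m)%N >-> n <= m}.
  by apply/nondecreasing_seqP => n; rewrite /series/= big_nat_recr//= lerDl.
have cf' : cvgn (series f) by apply/cvg_ex; exists 0.
have := nondecreasing_cvgn_le nd cf' j.+1.
rewrite (cvg_lim _ cf)//; apply: le_trans.
by rewrite /series /= big_nat_recr//= lerDr sumr_ge0.
Qed.

(** * Entrywise form of the norms *)

Lemma lpnorm_series (R : realType) (p N : R) (x : nat -> R[i]) : 0 < p ->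
  lpnorm p x = N%:E -> series (fun j => normc (x j) `^ p) @ \oo --> N `^ p.
Proof.
move=> p0 /(congr1 (fun t => t `^ p)%E).
have ge0 i : (0 <= (normc (x i) `^ p)%:E)%E by rewrite lee_fin powR_ge0.
rewrite /lpnorm -poweRrM mulVf ?gt_eqF// poweRe1; last exact: esum_ge0.
rewrite -nneseries_esumT// poweR_EFin => E.
have := @is_cvg_nneseries R (fun i => (normc (x i) `^ p)%:E) xpredT 0 (fun i _ _ => ge0 i).
rewrite E => /fine_cvg.
rewrite (_ : fine \o _ = series (fun j => normc (x j) `^ p))//.
by apply/funext => n; rewrite /series /= sumEFin.
Qed.

Lemma lpnorm_ge0 (R : realType) (I : choiceType) (p : R) (x : I -> R[i]) :
  (0 <= lpnorm p x)%E.
Proof. exact: poweR_ge0. Qed.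

Lemma lpnorm_sum (R : realType) (I : finType) (p N : R) (x : I -> R[i]) : 0 < p ->
  lpnorm p x = N%:E -> \sum_i normc (x i) `^ p = N `^ p.
Proof.
move=> p0; rewrite lpnorm_fin => -[<-].
by rewrite -powRrM mulVf ?gt_eqF// powRr1// sumr_ge0// => i _; exact: powR_ge0.
Qed.

(** * Hölder's inequality: convergence and equality *)

(** Young's inequality dominates the terms |u_j v_j| by a summable sequence. *)
Lemma csums_mul (R : realType) (p q M N : R) (u v : nat -> R[i]) :
  1 < p -> p^-1 + q^-1 = 1 -> lpnorm p u = M%:E -> lpnorm q v = N%:E ->
  csums (fun j => u j * v j) (csum (fun j => u j * v j)).
Proof.
move=> p1 pq uM vN.
have [q1 _] := conj_exp p1 pq.
have {uM} /(@lpnorm_series R) - /(_ ltac:(lra)) cu := uM.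
have {vN} /(@lpnorm_series R) - /(_ ltac:(lra)) cv := vN.
apply: (@csums_abs _ _ (fun j => normc (u j) `^ p / p + normc (v j) `^ q / q)).
  move=> j; rewrite normcM; apply: conjugate_powR; rewrite ?normc_ge0//; lra.
apply/cvg_ex; exists (M `^ p / p + N `^ q / q).
have -> : series (fun j => normc (u j) `^ p / p + normc (v j) `^ q / q) =
  (fun n => series (fun j => normc (u j) `^ p) n / p + series (fun j => normc (v j) `^ q) n / q).
  by apply/funext => n; rewrite /series /= big_split/= !mulr_suml.
by apply: cvgD; apply: cvgMr_tmp.
Qed.

(** The gaps D j in the termwise Young inequality are nonnegative, and by the
    normalisation they sum to 1 / p + 1 / q - 1 = 0: each term is a case of
    equality in Young's inequality. *)
Lemma holder_eq_series (R : realType) (p q N : R) (u v : nat -> R[i]) :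
  1 < p -> p^-1 + q^-1 = 1 -> 0 < N ->
  lpnorm p u = 1%E -> lpnorm q v = N%:E -> csums (fun j => u j * v j) N%:C ->
  forall j, cpow (v j) (q - 1) = (N `^ (q - 1))%:C * u j.
Proof.
move=> p1 pq N0 u1 vN uv j.
have [q1 _] := conj_exp p1 pq.
have {u1} cu := lpnorm_series (lt_trans ltr01 p1) u1.
have {vN} cv := lpnorm_series (lt_trans ltr01 q1) vN.
rewrite powR1 in cu.
apply: (young_eq_scaled p1 pq N0).
pose D j := normc (u j) `^ p / p + normc (v j) `^ q / (N `^ q * q) - complex.Re (u j * v j) / N.
have D0 i : 0 <= D i by rewrite subr_ge0 young_scaled.
have NN : N `^ q != 0 by rewrite gt_eqF ?powR_gt0.
have cD : series D @ \oo --> (0 : R).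
  have -> : 0 = 1 / p + N `^ q / (N `^ q * q) - N / N :> R.
    by rewrite divff ?gt_eqF// invfM mulrA divff//; lra.
  have -> : series D = (fun n => series (fun j => normc (u j) `^ p) n / p +
      series (fun j => normc (v j) `^ q) n / (N `^ q * q) -
      series (fun j => complex.Re (u j * v j)) n / N).
    by apply/funext => n; rewrite /series /= sumrB big_split/= !mulr_suml.
  apply: cvgB; last by apply: cvgMr_tmp; exact: csums_Re uv.
  by apply: cvgD; apply: cvgMr_tmp.
by rewrite -subr_le0 -/(D j) (cvg_series_eq0 D0 cD).
Qed.

Lemma holder_eq_sum (R : realType) (I : finType) (p q N : R) (u v : I -> R[i]) :
  1 < p -> p^-1 + q^-1 = 1 -> 0 < N ->
  lpnorm p u = 1%E -> lpnorm q v = N%:E -> \sum_i u i * v i = N%:C ->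
  forall i, cpow (v i) (q - 1) = (N `^ (q - 1))%:C * u i.
Proof.
move=> p1 pq N0 u1 vN uv j.
have [q1 _] := conj_exp p1 pq.
have {u1} cu := lpnorm_sum (lt_trans ltr01 p1) u1.
have {vN} cv := lpnorm_sum (lt_trans ltr01 q1) vN.
rewrite powR1 in cu.
apply: (young_eq_scaled p1 pq N0).
pose D j := normc (u j) `^ p / p + normc (v j) `^ q / (N `^ q * q) - complex.Re (u j * v j) / N.
have D0 i : 0 <= D i by rewrite subr_ge0 young_scaled.
have NN : N `^ q != 0 by rewrite gt_eqF ?powR_gt0.
have cD : \sum_i D i = 0.
  rewrite sumrB big_split/= -!mulr_suml cu cv.
  have -> : \sum_i complex.Re (u i * v i) = complex.Re (\sum_i u i * v i).
    by rewrite Re_sum.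
  by rewrite uv/= divff ?gt_eqF// invfM mulrA divff//; lra.
by rewrite -subr_le0 -/(D j) (psumr_eq0P (fun i _ => D0 i) cD).
Qed.

(** * Columns of an operator *)

Definition basis_vec (R : realType) m (k : 'I_m) : 'I_m -> R[i] :=
  fun i => (i == k)%:R.

Lemma mulmv_basis_vec (R : realType) m (M : nat -> 'I_m -> R[i]) (k : 'I_m) :
  mulmv M (basis_vec R k) = (fun j => M j k).
Proof.
apply/funext => j; rewrite /mulmv (bigD1 k)//= /basis_vec eqxx mulr1 big1 ?addr0//.
by move=> i /negbTE ->; rewrite mulr0.
Qed.

Lemma lpnorm_basis_vec (R : realType) m (q : R) (k : 'I_m) : 0 < q ->
  lpnorm q (basis_vec R k) = 1%E.
Proof.
move=> q0; rewrite lpnorm_fin (bigD1 k)//= /basis_vec eqxx normc1 powR1 big1.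
  by rewrite addr0 powR1.
by move=> i /negbTE ->; rewrite normc0 powR0// gt_eqF.
Qed.

Lemma lpnorm_column (R : realType) m (q : R) (M : nat -> 'I_m -> R[i]) (k : 'I_m) :
  0 < q -> (lpnorm q (fun j => M j k) <= opnorm q M)%E.
Proof.
move=> q0; apply: ereal_sup_ubound; exists (basis_vec R k) => /=.
  by rewrite lpnorm_basis_vec.
by rewrite mulmv_basis_vec.
Qed.

Lemma lpnorm_eq0 (R : realType) (q : R) (x : nat -> R[i]) : 0 < q ->
  lpnorm q x = 0%E -> forall j, x j = 0.
Proof.
move=> q0 x0 j; have := lpnorm_series q0 x0.
rewrite powR0 ?gt_eqF// => c; apply: eq0_normc; apply: (@powR_eq0_eq0 _ _ q).
by apply: (cvg_series_eq0 _ c) => i; exact: powR_ge0.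
Qed.

Lemma column_lpnorm_fin (R : realType) m (q N : R) (M : nat -> 'I_m -> R[i]) (k : 'I_m) :
  0 < q -> opnorm q M = N%:E -> exists c, lpnorm q (fun j => M j k) = c%:E.
Proof.
move=> q0 MN; have := lpnorm_column M k q0; rewrite MN.
have := lpnorm_ge0 q (fun j => M j k).
by case: lpnorm => // c _ _; exists c.
Qed.

(** * Maximizing pairs *)

Lemma powR_conj (R : realType) (p q N : R) : 0 < N -> (p - 1) * (q - 1) = 1 ->
  (N `^ (p - 1)) `^ (q - 1) * N `^ (q - 1) = N `^ q.
Proof.
move=> N0 pq1; rewrite -powRrM pq1 -powRD; last by rewrite (gt_eqF N0) implybT.
by rewrite subrKC.
Qed.

(** Hb and Ha below are the two cases of equality in Hölder's inequality, for
    b against M a and for a against M^T b; substituting each into the other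
    gives the two formulas. That the norm is finite puts the columns of M in
    l^q, so that the series defining M^T b converge and the pairing can be
    moved across M. *)
Lemma extremal_pair (R : realType) (p q N : R) m (M : nat -> 'I_m -> R[i])
    (a : 'I_m -> R[i]) (b : nat -> R[i]) :
  1 < p -> p^-1 + q^-1 = 1 -> 0 < N -> opnorm q M = N%:E ->
  lpnorm q a = 1%E -> lpnorm p b = 1%E ->
  lpnorm q (mulmv M a) = N%:E -> lpnorm p (mulmvT M b) = N%:E ->
  pairing b (mulmv M a) = N%:C ->
  (forall k, a k = vpow (mulmvT M (vpow (mulmv M a) (q - 1))) (p - 1) k
     / (N `^ p)%:C) /\
  (forall j, b j = vpow (mulmv M (vpow (mulmvT M b) (p - 1))) (q - 1) j
     / (N `^ q)%:C).
Proof.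
move=> p1 pq N0 MN a1 b1 MaN MbN baN.
have [q1 pq1] := conj_exp p1 pq.
have qp : q^-1 + p^-1 = 1 by rewrite addrC.
have cb : csums (fun j => b j * mulmv M a j) N%:C.
  by rewrite -baN; exact: csums_mul p1 pq b1 MaN.
have Hb := holder_eq_series p1 pq N0 b1 MaN cb.
have cM k : csums (fun j => M j k * b j) (mulmvT M b k).
  have [c Mc] := column_lpnorm_fin k (lt_trans ltr01 q1) MN.
  have := csums_mul q1 qp Mc b1; exact.
have sa : \sum_k a k * mulmvT M b k = N%:C.
  rewrite -(csums_unique cb); apply/esym/csums_unique.
  have := csums_sum (fun k => @csumsZ R (a k) _ _ (cM k)).
  congr csums; apply/funext => j; rewrite /mulmv mulr_sumr.
  by apply: eq_bigr => k _; ring.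
have Ha := holder_eq_sum q1 qp N0 a1 MbN sa.
split=> [k|j].
- have -> : vpow (mulmvT M (vpow (mulmv M a) (q - 1))) (p - 1) k =
      cpow ((N `^ (q - 1))%:C * mulmvT M b k) (p - 1).
    congr cpow; apply: csums_unique.
    have := @csumsZ R (N `^ (q - 1))%:C _ _ (cM k).
    by congr csums; apply/funext => j; rewrite /vpow Hb mulrCA.
  rewrite cpow_scale ?powR_gt0// Ha mulrA -rmorphM/=.
  by rewrite powR_conj// 1?mulrC// mulKf// realc_eq0 gt_eqF// powR_gt0.
- have -> : vpow (mulmv M (vpow (mulmvT M b) (p - 1))) (q - 1) j =
      cpow ((N `^ (p - 1))%:C * mulmv M a j) (q - 1).
    congr cpow; rewrite /mulmv mulr_sumr; apply: eq_bigr => k _.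
    by rewrite /vpow Ha mulrCA.
  rewrite cpow_scale ?powR_gt0// Hb mulrA -rmorphM/=.
  by rewrite powR_conj// mulrC mulKf// realc_eq0 gt_eqF// powR_gt0.
Qed.

Theorem corollary5p6 (R : realType) (p q : R) (n : nat) (z : 'I_n.+1 -> R[i])
    (a : 'I_n.+1 -> R[i]) (b : nat -> R[i])
    (hp : 1 < p) (hpq : p^-1 + q^-1 = 1)
    (hz : injective z) (hzD : forall k, normc (z k) < 1)
    (ha : lpnorm q a = 1%E) (hb : lpnorm p b = 1%E)
    (hPa : lpnorm q (mulmv (Psi q z) a) = opnorm q (Psi q z))
    (hPb : lpnorm p (mulmvT (Psi q z) b) = opnorm q (Psi q z))
    (hab : pairing b (mulmv (Psi q z) a) = (fine (opnorm q (Psi q z)))%:C) :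
  (forall k : 'I_n.+1,
     a k = vpow (mulmvT (Psi q z) (vpow (mulmv (Psi q z) a) (q - 1))) (p - 1) k
           / (fine (opnorm q (Psi q z)) `^ p)%:C) /\
  (forall j : nat,
     b j = vpow (mulmv (Psi q z) (vpow (mulmvT (Psi q z) b) (p - 1))) (q - 1) j
           / (fine (opnorm q (Psi q z)) `^ q)%:C).
Proof.
have [q1 _] := conj_exp hp hpq.
have q0 : 0 < q := lt_trans ltr01 q1.
have fN : opnorm q (Psi q z) = (fine (opnorm q (Psi q z)))%:E.
  by rewrite -hPb lpnorm_fin.
(* row 0 of Psi has no zero entry, because z ^+ 0 = 1 and |z| < 1 *)
have N0 : 0 < fine (opnorm q (Psi q z)).
  rewrite lt0r -lee_fin -fN -{2}hPb lpnorm_ge0 andbT.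
  apply/eqP => N0; have := lpnorm_column (Psi q z) ord0 q0.
  rewrite fN N0 => h.
  have /(lpnorm_eq0 q0)/(_ 0%N) : lpnorm q (fun j => Psi q z j ord0) = 0%E.
    by apply/le_anti; rewrite h lpnorm_ge0.
  move/eqP; rewrite /Psi expr0 mul1r realc_eq0.
  apply/negP; rewrite gt_eqF// powR_gt0// subr_gt0.
  have : normc (z ord0) `^ q < 1 `^ q.
    by apply: gt0_ltr_powR => //; rewrite ?nnegrE ?normc_ge0.
  by rewrite powR1.
apply: (extremal_pair hp hpq N0 fN ha hb) => //.
- by rewrite hPa.
- by rewrite hPb.
Qed.
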